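(* Let $G$ be a soluble group. (1) $\mathcal{L}(G)$ coincides with the Hirsch-Plotkin radical of $G$ and is a Gruenberg group. In particular, $\mathcal{L}(G)=L(G)$. (2) $\overline{\mathcal{L}}(G)$ coincides with the Baer radical of $G$. In particular, $\overline{\mathcal{L}}(G)=\overline{L}(G)$.
   Context: Notation: $a^g=g^{-1}ag$, $[x,y]=x^{-1}y^{-1}xy$, $[x_1]=x_1$, $[x_1,\dots,x_n]=[[x_1,\dots,x_{n-1}],x_n]$ for $n>1$; $[x,_k y]=[x,y,\dots,y]$ with $k$ copies of $y$. An element $x\in G$ is left Engel if for every $a\in G$ there is a positive integer $k$ with $[a,_k x]=1$; it is bounded left Engel if a single positive integer $k$ works for all $a\in G$. $L(G)$ and $\overline{L}(G)$ are the sets of left Engel and bounded left Engel elements of $G$. An element $a\in G$ is randomly power Engel if for every $g\in G$ there is a sequence $a_1,\dots,a_k$ (with $k\geq 1$) of elements of $\langle a\rangle$ with $\langle a_i\rangle=\langle a\rangle$ for all $i$ such that either $[a_1^g,a_2,\dots,a_k]=1$ or $[a_1,a_2^g,\dots,a_k^g]=1$. If the integer $k$ can be taken the same for all $g\in G$, then $a$ is randomly power $k$-Engel; $a$ is bounded randomly power Engel if it is randomly power $k$-Engel for some positive integer $k$. $\mathcal{L}(G)$ and $\overline{\mathcal{L}}(G)$ are the sets of randomly power Engel and bounded randomly power Engel elements of $G$. The Hirsch-Plotkin radical of $G$ is its largest locally nilpotent normal subgroup. A Gruenberg group is a group in which every cyclic subgroup is ascendant. The Baer radical of $G$ is the subgroup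 generated by all cyclic subnormal subgroups of $G$; it is the set of all $x\in G$ such that $\langle x\rangle$ is subnormal in $G$. *)

(* Defs.v *)
From mathcomp Require Import all_boot.
From mathcomp Require Import boolp classical_sets.
From mathcomp Require wochoice.

Set Implicit Arguments.
Unset Strict Implicit.
Unset Printing Implicit Defensive.

Local Open Scope classical_set_scope.
Local Open Scope group_scope.

(* Arbitrary (possibly infinite) groups are modelled by [groupType] of monoid.v
   in MathComp, where [x ^ g = g^-1 * (x * g)] and
   [[~ x, y] = x^-1 * (y^-1 * (x * y))]; subgroups are classical sets
   [H : set G] satisfying [is_subgroup H]. *)

Section Subgroups.
Context {G : groupType}.
Implicit Types (H K N A : set G) (x : G).

Definition is_subgroup H : Prop :=
  [/\ H 1, forall x y, H x -> H y -> H (x * y) & forall x, H x -> H x^-1].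

Definition gen A : set G := smallest is_subgroup A.

Definition cyc x : set G := gen [set x].

Definition normal_in N K : Prop :=
  [/\ is_subgroup N, is_subgroup K, N `<=` K
    & forall n k, N n -> K k -> N (n ^ k)].

Definition commsg H K : set G :=
  gen [set z | exists x y, [/\ H x, K y & z = [~ x, y]]].

Definition derived H (n : nat) : set G := iter n (fun K => commsg K K) H.

Definition soluble H : Prop := exists n, derived H n = [set 1].

Definition lower_central H (n : nat) : set G := iter n (fun K => commsg K H) H.

Definition nilpotent H : Prop := exists n, lower_central H n = [set 1].

Definition locally_nilpotent H : Prop :=
  forall s : seq G, [set` s] `<=` H -> nilpotent (gen [set` s]).

Definition is_Hirsch_Plotkin_radical N : Prop :=
  [/\ normal_in N [set: G], locally_nilpotent N
    & forall M, normal_in M [set: G] -> locally_nilpotent M -> M `<=` N].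

Definition subnormal H K : Prop :=
  exists (n : nat) (S : nat -> set G),
    [/\ S 0%N = H, S n = K
      & forall i, (i < n)%N -> normal_in (S i) (S i.+1)].

Definition Baer_radical : set G :=
  gen (\bigcup_(x in [set x | subnormal (cyc x) [set: G]]) cyc x).

End Subgroups.

Section Ascendant.
Context {I : Type} (le : rel I).

Definition before (i j : I) : Prop := le i j /\ i <> j.

Definition succ_of (i j : I) : Prop :=
  before i j /\ forall k, ~ (before i k /\ before k j).

(* [j] is neither the least element nor a successor. *)
Definition limit_index (j : I) : Prop :=
  (exists i, before i j) /\ forall i, ~ succ_of i j.

End Ascendant.

(* The ordinals [<= alpha] indexing an ascending series are represented by a
   well-ordered type [I] with greatest element [t] (and least element [b]);
   [wochoice.well_order] is about the reflexive order [le]. *)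
Definition ascendant {G : groupType} (H K : set G) : Prop :=
  exists (I : Type) (le : rel I) (b t : I) (S : I -> set G),
    [/\ wochoice.well_order le, forall i, le b i & forall i, le i t] /\
    [/\ forall i, is_subgroup (S i), S b = H, S t = K,
        forall i j, succ_of le i j -> normal_in (S i) (S j)
      & forall j, limit_index le j ->
          S j = \bigcup_(i in [set i | before le i j]) S i].

Definition Gruenberg {G : groupType} (H : set G) : Prop :=
  is_subgroup H /\ forall x, H x -> ascendant (cyc x) H.

Section Engel.
Context {G : groupType}.
Implicit Types (a g x : G) (s : seq G) (k : nat).

(* [lncomm x1 [:: x2; ...; xn]] is the left-normed commutator
   [x1, x2, ..., xn]. *)
Definition lncomm x1 s : G := foldl (@commg G) x1 s.

Definition left_Engel : set G :=
  [set x | forall a, exists2 k, (0 < k)%N & lncomm a (nseq k x) = 1].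

Definition bounded_left_Engel : set G :=
  [set x | exists2 k, (0 < k)%N & forall a, lncomm a (nseq k x) = 1].

(* The sequence a_1, ..., a_k is [a1 :: s]; in particular [k >= 1]. *)
Definition power_Engel_at k a g : Prop :=
  exists (a1 : G) (s : seq G),
    [/\ size (a1 :: s) = k,
        forall b, b \in a1 :: s -> cyc a b /\ cyc b = cyc a
      & lncomm (a1 ^ g) s = 1 \/ lncomm a1 [seq b ^ g | b <- s] = 1].

Definition randomly_power_Engel : set G :=
  [set a | forall g, exists2 k, (0 < k)%N & power_Engel_at k a g].

Definition bounded_randomly_power_Engel : set G :=
  [set a | exists2 k, (0 < k)%N & forall g, power_Engel_at k a g].

End Engel.

Arguments left_Engel : clear implicits.
Arguments bounded_left_Engel : clear implicits.
Arguments randomly_power_Engel : clear implicits.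
Arguments bounded_randomly_power_Engel : clear implicits.
Arguments Baer_radical : clear implicits.

(* Main.v *)
Require Import Defs.
From HB Require Import structures.
From mathcomp Require Import all_boot.
From mathcomp Require Import boolp classical_sets.
From mathcomp Require wochoice.
From mathcomp Require Import zify.

(** The factors of the derived series of [G] are abelian, and conjugation makes
    each of them a module on which the notions at stake turn into linear
    algebra.  Say that [x] is unipotent on an abelian section [A / B] when every
    element of it is annihilated by some power of [x - 1].  Everything is
    compared with the set [U] of the elements that are unipotent on all derived
    factors ([derived_unipotent]).

    Randomly power Engel elements lie in [U].  For [b] in [A] and generators
    [a_1], ..., [a_k] of the cyclic group of [a], the [a_i] commute, so
    [[a_1 ^ b, a_2, ..., a_k] = [a_1, b, a_2, ..., a_k]], and the vanishing of
    this commutator says that [(a_1 - 1) ... (a_k - 1)] annihilates [b].  Since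
    [a_i] and [a] have the same fixed points on every section, each factor may
    be replaced by [a - 1]: hence [(a - 1) ^ k] annihilates [b]
    ([power_Engel_hyperfixed]).

    Finitely many elements of [U] generate a nilpotent group
    ([derived_unipotent_nilpotent]).  If the long commutators in these elements
    lie in [A], they act trivially on [A / B], so the acting group is nilpotent;
    a nilpotent group generated by finitely many unipotent elements has a
    nontrivial fixed point on every nonzero module
    ([nilpotent_unipotent_closed]), whence every element of [A] is annihilated by
    all sufficiently long products of the [x - 1], and longer commutators fall
    into [B] ([comms_descent]).

    As [U] is invariant under conjugation, it generates a locally nilpotent
    normal subgroup.  The elements of such a subgroup are left Engel, left Engel
    elements are randomly power Engel, and these lie in [U]: the sets agree, and
    they form the Hirsch-Plotkin radical.

    For ascendance, let [E_j] be the elements of [D n] annihilated by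
    [(x - 1) ^ j] modulo [D n.+1].  Each product [<x> E_j] is normal in
    [<x> E_(j+1)], and unipotence says that these products climb from
    [<x> D n.+1] to [<x> D n].  With a common exponent [k] for all elements the
    climb takes [k] steps and [<x>] is subnormal.  Conversely, if [<x>] is
    subnormal then [x] is boundedly left Engel, so the Baer radical consists of
    such elements provided that they form a subgroup.  This follows from the
    unbounded case: [x] is bounded left Engel in [G] exactly when the constant
    function [x] is left Engel in the soluble group of all functions from [G] to
    [G], because the exponent found for the identity function serves all
    elements of [G] at once ([bounded_left_Engel_diag]). *)

Set Implicit Arguments.
Unset Strict Implicit.
Unset Printing Implicit Defensive.

Local Open Scope classical_set_scope.
Local Open Scope group_scope.

(** * Subgroups and commutators *)

Section Basics.
Context {G : groupType}.
Implicit Types (H K A B C T : set G) (x y z a b k t : G).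

Lemma commMgR x y z : [~ x * y, z] = [~ x, z] ^ y * [~ y, z].
Proof. by rewrite /commg /conjg !gnorm. Qed.

Lemma commgMR x y z : [~ x, y * z] = [~ x, z] * [~ x, y] ^ z.
Proof. by rewrite /commg /conjg !gnorm. Qed.

Lemma commVgR x y : [~ x^-1, y] = ([~ x, y]^-1) ^ x^-1.
Proof. by rewrite /commg /conjg !gnorm. Qed.

Lemma commgVR x y : [~ x, y^-1] = ([~ x, y]^-1) ^ y^-1.
Proof. by rewrite /commg /conjg !gnorm. Qed.

Lemma conjg_mulR x y : x ^ y = x * [~ x, y].
Proof. by rewrite /commg mulVKg. Qed.

Lemma gen_subgroup A : is_subgroup (gen A).
Proof.
split=> [M [[]] //|x y xA yA M AM|x xA M AM].
  by case: (AM) => -[_ mulM _] _; apply: mulM; [apply: xA|apply: yA].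
by case: (AM) => -[_ _ invM] _; apply: invM; apply: xA.
Qed.

Lemma sub_gen A : A `<=` gen A.
Proof. exact: sub_gen_smallest. Qed.

Lemma gen_sub A H : is_subgroup H -> A `<=` H -> gen A `<=` H.
Proof. exact: smallest_sub. Qed.

Lemma gen_mono A B : A `<=` B -> gen A `<=` gen B.
Proof. by move=> sAB; apply: gen_sub; [exact: gen_subgroup|move=> x /sAB/sub_gen]. Qed.

Lemma setT_subgroup : is_subgroup [set: G].
Proof. by split. Qed.

Lemma cyc_id x : cyc x x.
Proof. exact: sub_gen. Qed.

Lemma cyc_subgroup x : is_subgroup (cyc x).
Proof. exact: gen_subgroup. Qed.

Lemma cyc_sub x H : is_subgroup H -> H x -> cyc x `<=` H.
Proof. by move=> sgH Hx; apply: gen_sub => // _ ->. Qed.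

Section Closure.
Variable H : set G.
Hypothesis sgH : is_subgroup H.

Lemma sgrp1 : H 1. Proof. by case: sgH. Qed.

Lemma sgrpM x y : H x -> H y -> H (x * y). Proof. by case: sgH => _ + _; apply. Qed.

Lemma sgrpV x : H x -> H x^-1. Proof. by case: sgH => _ _; apply. Qed.

Lemma sgrpJ x y : H x -> H y -> H (x ^ y).
Proof. by move=> Hx Hy; rewrite conjgE; do !apply: sgrpM => //; exact: sgrpV. Qed.

Lemma sgrpR x y : H x -> H y -> H [~ x, y].
Proof. by move=> Hx Hy; apply: sgrpM; [exact: sgrpV|exact: sgrpJ]. Qed.

Lemma sgrpRC x y : H [~ x, y] -> H [~ y, x].
Proof. by rewrite -[[~ y, x]]invgR; exact: sgrpV. Qed.

End Closure.

Definition normalises K A : Prop := forall a k, K k -> A a -> A (a ^ k).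

Lemma normalisesR K A a k : is_subgroup A -> normalises K A ->
  K k -> A a -> A [~ a, k].
Proof. by move=> sgA nA Kk Aa; apply: sgrpM => //; [exact: sgrpV|exact: nA]. Qed.

Lemma lncommJ a s k : lncomm a s ^ k = lncomm (a ^ k) [seq b ^ k | b <- s].
Proof. by elim: s a => //= b s IHs a; rewrite IHs conjRg. Qed.

Lemma lncomm_nseqS a n x : lncomm a (nseq n.+1 x) = [~ lncomm a (nseq n x), x].
Proof. by rewrite -addn1 nseqD /lncomm foldl_cat. Qed.

End Basics.

(** * Fixed points modulo a subgroup *)

Section Fixed.
Context {G : groupType}.
Implicit Types (H K A B C T : set G) (x y z a b k t : G) (X : seq G).

(** The fixed points of [T] on [A / B], as a subset of [A]. *)
Definition fixed_mod T A B : set G :=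
  [set a | A a /\ forall t, T t -> B [~ a, t]].

Lemma fixed_mod_subgroup T A B : is_subgroup A -> is_subgroup B ->
  normalises A B -> is_subgroup (fixed_mod T A B).
Proof.
move=> sgA sgB nB; split.
- by split=> [|t _]; [exact: sgrp1|rewrite comm1g; exact: sgrp1].
- move=> a b [Aa fa] [Ab fb]; split=> [|t Tt]; first exact: sgrpM.
  by rewrite commMgR; apply: (sgrpM sgB); [apply: nB => //; exact: fa|exact: fb].
- move=> a [Aa fa]; split=> [|t Tt]; first exact: sgrpV.
  by rewrite commVgR; apply: nB; [exact: sgrpV|apply: (sgrpV sgB); exact: fa].
Qed.

(** The elements under which a given [a] is fixed modulo [B] form a subgroup. *)
Lemma fixed_mod_gen T A B a k : is_subgroup B -> normalises (gen T) B ->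
  fixed_mod T A B a -> gen T k -> B [~ a, k].
Proof.
move=> sgB nB [_ fa] gk.
suff: gen T `<=` [set k | gen T k /\ B [~ a, k]] by case/(_ k gk).
have [g1 gM gV] := gen_subgroup T.
apply: gen_sub => [|t Tt]; last by split; [exact: sub_gen|exact: fa].
split=> [|x y [gx Bx] [gy By]|x [gx Bx]].
- by split=> //; rewrite commg1; exact: sgrp1.
- split; first exact: gM.
  by rewrite commgMR; apply: sgrpM => //; exact: nB.
- by split; [exact: gV|rewrite commgVR; apply: nB; [exact: gV|exact: sgrpV]].
Qed.

Lemma fixed_mod_normalised K T A B : is_subgroup K ->
  normalises K A -> normalises K B ->
  (forall a k t, fixed_mod T A B a -> K k -> T t -> B [~ a, t ^ k]) ->
  normalises K (fixed_mod T A B).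
Proof.
move=> sgK nA nB fT a k Kk fa; split=> [|t Tt]; first by apply: nA => //; case: fa.
rewrite -[t](conjgKV k) -conjRg; apply: nB => //.
by apply: fT => //; exact: sgrpV.
Qed.

(** For [T = [set x]] these are the elements annihilated by [(x - 1) ^ n] modulo
    [B]; in general, those sent into [B] by every left-normed commutator with
    [n] entries from [T], which is the [n]-th term of an upper central series. *)
Definition hyperfixed T A B n : set G := iter n (fixed_mod T A) B.

(** The module [A / B] for the conjugation action of [K] is handled through the
    pair [A], [B], equality in it being congruence modulo [B]. *)
Record abelian_section K A B : Prop := AbelianSection {
  sec_top : is_subgroup A;
  sec_bot : is_subgroup B;
  sec_sub : B `<=` A;
  sec_abelian : forall a b, A a -> A b -> B [~ a, b];
  sec_normtop : normalises K A;
  sec_normbot : normalises K B }.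

Lemma section_norm K A B : abelian_section K A B -> normalises A B.
Proof.
move=> s b a Aa Bb; rewrite conjg_mulR; apply: (sgrpM (sec_bot s)) => //.
by apply: (sec_abelian s) => //; exact: (sec_sub s).
Qed.

Lemma sub_section K H A B : H `<=` K ->
  abelian_section K A B -> abelian_section H A B.
Proof. by move=> sHK [? ? ? ? nA nB]; split=> // a k /sHK; [exact: nA|exact: nB]. Qed.

(** The elements of [K] acting trivially on [A / B] are the fixed points of [A]
    in [K] modulo [B], so this kernel inherits its closure properties. *)
Definition action_kernel K A B : set G := fixed_mod A K B.

Lemma action_kernelP K A B k a : is_subgroup B ->
  action_kernel K A B k -> A a -> B [~ a, k].
Proof. by move=> sgB [_ fk] Aa; apply: sgrpRC => //; exact: fk. Qed.

Lemma action_kernel_subgroup K A B : is_subgroup K -> abelian_section K A B ->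
  is_subgroup (action_kernel K A B).
Proof.
by move=> sgK s; apply: fixed_mod_subgroup => //; [exact: sec_bot s|exact: sec_normbot s].
Qed.

Lemma action_kernel_norm K A B : is_subgroup K -> abelian_section K A B ->
  normalises K (action_kernel K A B).
Proof.
move=> sgK s; apply: fixed_mod_normalised => //.
- by move=> a k Kk Ka; exact: sgrpJ.
- exact: sec_normbot s.
- by move=> a k t [_ fa] Kk At; apply: fa; exact: (sec_normtop s).
Qed.

(** Elements with this property have a [K]-invariant set of fixed points on
    every section on which [C] acts trivially, for then the conjugates of [T]
    act as products of elements of [T]. *)
Definition normal_mod K C T : Prop :=
  [/\ T `<=` K, C `<=` K & forall k t, K k -> T t -> gen (T `|` C) (t ^ k)].

Lemma normal_mod_gen C T : C `<=` gen T -> normal_mod (gen T) C T.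
Proof.
move=> sC; split=> // [|k t Kk Tt]; first exact: sub_gen.
apply: (sgrpJ (gen_subgroup _)); first by apply: sub_gen; left.
by apply: gen_mono Kk => x; left.
Qed.

Lemma normal_mod_central K C T : C `<=` K -> T `<=` fixed_mod K K C ->
  normal_mod K C T.
Proof.
move=> sCK cT; split=> // [t /cT[]//|k t Kk Tt].
rewrite conjg_mulR; apply: (sgrpM (gen_subgroup _)); first by apply: sub_gen; left.
by apply: sub_gen; right; case: (cT _ Tt) => _; apply.
Qed.

Section FixedSection.
Variables (K A B T : set G).
Hypotheses (sgK : is_subgroup K) (sAB : abelian_section K A B).
Hypothesis nT : normal_mod K (action_kernel K A B) T.

Let sgA := sec_top sAB.
Let sgB := sec_bot sAB.

Let fixed_sub : fixed_mod T A B `<=` A. Proof. by move=> a []. Qed.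

Let sub_fixed : B `<=` fixed_mod T A B.
Proof.
case: nT => sTK _ _ b Bb; split=> [|t /sTK Kt]; first exact: (sec_sub sAB).
exact: (normalisesR sgB (sec_normbot sAB)).
Qed.

Let fixed_subgroup : is_subgroup (fixed_mod T A B).
Proof. by apply: fixed_mod_subgroup => //; exact: section_norm sAB. Qed.

Let fixed_norm : normalises K (fixed_mod T A B).
Proof.
case: nT => sTK sCK gT; apply: fixed_mod_normalised => //.
- exact: sec_normtop sAB.
- exact: sec_normbot sAB.
move=> a k t [Aa fa] Kk Tt.
apply: (@fixed_mod_gen (T `|` action_kernel K A B) A) => //.
- have sTC : gen (T `|` action_kernel K A B) `<=` K.
    by apply: gen_sub => // x [/sTK|/sCK].
  by move=> b h /sTC; exact: (sec_normbot sAB).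
- by split=> // h [/fa//|Ch]; exact: action_kernelP Ch Aa.
- exact: gT.
Qed.

Lemma section_fixed_bot : abelian_section K (fixed_mod T A B) B.
Proof.
split=> //; last exact: sec_normbot sAB.
by move=> a b /fixed_sub Aa /fixed_sub Ab; exact: (sec_abelian sAB).
Qed.

Lemma section_fixed_top : abelian_section K A (fixed_mod T A B).
Proof.
split=> //; last exact: sec_normtop sAB.
by move=> a b Aa Ab; apply: sub_fixed; exact: (sec_abelian sAB).
Qed.

Lemma sub_fixed_mod : B `<=` fixed_mod T A B. Proof. exact: sub_fixed. Qed.

End FixedSection.

Lemma action_kernel_mono K A A' B B' : A' `<=` A -> B `<=` B' ->
  action_kernel K A B `<=` action_kernel K A' B'.
Proof. by move=> sA sB k [Kk fk]; split=> // a /sA/fk/sB. Qed.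

Lemma normal_mod_mono K C C' T : C `<=` C' -> C' `<=` K ->
  normal_mod K C T -> normal_mod K C' T.
Proof.
move=> sC sC'K [sTK _ gT]; split=> // k t Kk /(gT _ _ Kk).
by apply: gen_mono => x [?|/sC ?]; [left|right].
Qed.

Section Hyperfixed.
Variables (K A B T : set G).
Hypotheses (sgK : is_subgroup K) (sAB : abelian_section K A B).
Hypothesis nT : normal_mod K (action_kernel K A B) T.

(** Enlarging [B] to the fixed points enlarges the kernel of the action, so the
    hypothesis on [T] persists at each stage. *)
Lemma hyperfixed_section n :
  abelian_section K A (hyperfixed T A B n) /\ B `<=` hyperfixed T A B n.
Proof.
elim: n => [|n [sn Bn]]; first by split.
have nTn : normal_mod K (action_kernel K A (hyperfixed T A B n)) T.
  by apply: normal_mod_mono nT; [exact: action_kernel_mono|move=> x []].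
split; first exact: section_fixed_top.
by move=> x /Bn; exact: (sub_fixed_mod sn nTn).
Qed.

Lemma hyperfixed_mono m n : m <= n ->
  hyperfixed T A B m `<=` hyperfixed T A B n.
Proof.
move/subnK <-; elim: (n - m)%N => // p IHp x /IHp.
have [sn Bn] := hyperfixed_section (p + m).
apply: (sub_fixed_mod sn).
by apply: normal_mod_mono nT; [exact: action_kernel_mono|move=> y []].
Qed.

Definition hyperfixed_union : set G := [set a | exists n, hyperfixed T A B n a].

Lemma hyperfixed_union_section : abelian_section K A hyperfixed_union.
Proof.
split.
- exact: sec_top sAB.
- split.
  + by exists 0%N; exact: sgrp1 (sec_bot sAB).
  + move=> x y [m xm] [n yn]; exists (maxn m n).
    have [s _] := hyperfixed_section (maxn m n).
    apply: (sgrpM (sec_bot s)).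
      by apply: hyperfixed_mono xm; exact: leq_maxl.
    by apply: hyperfixed_mono yn; exact: leq_maxr.
  + move=> x [n xn]; exists n; have [s _] := hyperfixed_section n.
    exact: (sgrpV (sec_bot s)).
- by move=> a [n]; have [s _] := hyperfixed_section n; exact: (sec_sub s).
- by move=> a b Aa Ab; exists 0%N; exact: (sec_abelian sAB).
- exact: sec_normtop sAB.
- move=> a k Kk [n an]; exists n; have [s _] := hyperfixed_section n.
  exact: (sec_normbot s).
Qed.

End Hyperfixed.

Lemma uniform_stage (P : nat -> set G) X :
  (forall m n, m <= n -> P m `<=` P n) ->
  (forall x, x \in X -> exists n, P n x) ->
  exists n, forall x, x \in X -> P n x.
Proof.
move=> monoP; elim: X => [|y X IHX] PX; first by exists 0%N.
have [m Pm] := PX y (mem_head _ _).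
have [|n Pn] := IHX; first by move=> x xX; apply: PX; rewrite inE xX orbT.
exists (maxn m n) => x; rewrite inE => /orP[/eqP->|/Pn].
  exact: monoP (leq_maxl _ _) _ Pm.
exact/monoP/leq_maxr.
Qed.

(** This is where finiteness of [X] matters: the stages reached by the
    commutators [[~ a, x]] have a common bound. *)
Lemma hyperfixed_union_closed K A B X a : is_subgroup K -> abelian_section K A B ->
  normal_mod K (action_kernel K A B) [set` X] -> A a ->
  (forall x, x \in X -> hyperfixed_union A B [set` X] [~ a, x]) ->
  hyperfixed_union A B [set` X] a.
Proof.
move=> sgK sAB nX Aa Xa.
have mono m n : m <= n ->
    [set x | hyperfixed [set` X] A B m [~ a, x]] `<=`
    [set x | hyperfixed [set` X] A B n [~ a, x]].
  by move=> mn x; exact: (hyperfixed_mono sgK sAB nX mn).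
have [n Xn] := uniform_stage mono Xa.
by exists n.+1; split=> // x; exact: Xn.
Qed.

End Fixed.

(** * Groups generated by finitely many unipotent elements *)

Section Unipotent.
Context {G : groupType}.
Implicit Types (H K A B C T : set G) (x y z a b k t : G) (X : seq G).

Definition unipotent x A B : Prop :=
  forall a, A a -> exists n, B (lncomm a (nseq n x)).

Lemma hyperfixed1P x A B n a : hyperfixed [set x] A B n a -> B (lncomm a (nseq n x)).
Proof. by elim: n a => // n IHn a [_ /(_ x erefl)/IHn]. Qed.

(** Conjugation by [y] is an automorphism of the module [A / B]. *)
Lemma unipotentJ K x y A B : is_subgroup K -> abelian_section K A B ->
  K y -> unipotent x A B -> unipotent (x ^ y) A B.
Proof.
move=> sgK s Ky ux a Aa.
have [|n Bn] := ux (a ^ y^-1); first exact: (sec_normtop s) (sgrpV sgK Ky) _.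
exists n; rewrite -[a](conjgKV y) -(map_nseq n (conjg^~ y)) -lncommJ.
exact: (sec_normbot s).
Qed.

(** The module [A / B] has no nonzero fixed point under [X].  To prove that
    [A / B] vanishes it is enough to meet this condition after enlarging [B],
    which replaces counting exponents in the arguments below. *)
Definition fixed_closed X A B : Prop :=
  forall a, A a -> (forall x, x \in X -> B [~ a, x]) -> B a.

(** The last nonzero term of [a, [a, x], [a, x, x], ...] would be fixed by [x]. *)
Lemma unipotent_closed x A B K : abelian_section K A B -> K x ->
  unipotent x A B -> fixed_closed [:: x] A B -> A `<=` B.
Proof.
move=> s Kx ux cx a Aa; have [n] := ux a Aa.
elim: n a Aa => // n IHn a Aa Bn.
apply: cx => // _ /[!inE]/eqP->; apply: IHn => //.
exact: (normalisesR (sec_top s) (sec_normtop s)).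
Qed.

(** A common fixed point is found by restricting to the fixed points of one
    element at a time: these are a submodule, as the elements of [X] act
    centrally. *)
Lemma commuting_unipotent_closed K A B X : is_subgroup K ->
  abelian_section K A B ->
  [set` X] `<=` fixed_mod K K (action_kernel K A B) ->
  (forall x, x \in X -> unipotent x A B) ->
  fixed_closed X A B -> A `<=` B.
Proof.
move=> sgK; elim: X A => [|x X IHX] A s cX uX closed.
  by move=> a Aa; exact: closed.
have Kx : K x by case: (cX x); rewrite //= mem_head.
have sx : abelian_section K (fixed_mod [set x] A B) B.
  apply: (section_fixed_bot sgK s); apply: normal_mod_central => [y []//|_ ->].
  by apply: cX; rewrite /= mem_head.
apply: (unipotent_closed s Kx); first by apply: uX; rewrite mem_head.
move=> a Aa Ba; apply: (IHX _ sx) => [y Xy|y Xy|b [Ab bx] bX|].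
- have [|Ky cy] := cX y; first by rewrite /= inE [y \in X]Xy orbT.
  by split=> // k /cy; apply: action_kernel_mono => // b [].
- by move=> b [Ab _]; apply: uX => //; rewrite inE Xy orbT.
- by apply: closed => // y; rewrite inE => /orP[/eqP->|/bX//]; exact: bx.
- by split=> // _ ->; apply: Ba; rewrite inE.
Qed.

(** On [A / B] the commutator is the product of [x] and the inverse of [x ^ y];
    these commute since their quotient is central, and both are unipotent. With
    [B'] the part of [A] annihilated by powers of [t - 1], a common fixed point
    of [x] and [x ^ y] on [A / B'] would be fixed by [t], hence vanish. *)
Lemma unipotent_commg K A B x y : is_subgroup K -> abelian_section K A B ->
  K x -> K y -> unipotent x A B ->
  fixed_mod K K (action_kernel K A B) [~ y, x] -> unipotent [~ y, x] A B.
Proof.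
move=> sgK sAB Kx Ky ux; set t := [~ y, x] => ct.
set C := action_kernel K A B in ct.
have sgC : is_subgroup C by exact: action_kernel_subgroup.
have nC : normalises K C by exact: action_kernel_norm.
have sCK : C `<=` K by move=> k [].
have ntK : normal_mod K C [set t] by apply: normal_mod_central => // _ ->.
pose B' := hyperfixed_union A B [set t].
have sAB' : abelian_section K A B' by exact: hyperfixed_union_section.
have sBB' : B `<=` B' by move=> b Bb; exists 0%N.
suff sAB'A : A `<=` B' by move=> a /sAB'A[n /hyperfixed1P]; exists n.
(* [K0] is the centraliser of [x] modulo the kernel: [x], [t] and therefore
   [x ^ y] act centrally for it, though [x] need not for [K]. *)
pose K0 := fixed_mod [set x] K C.
have sgK0 : is_subgroup K0 by exact: fixed_mod_subgroup.
have sK0 : K0 `<=` K by move=> k [].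
have Kt : K t by case: ct.
have K0x : K0 x by split=> // _ ->; rewrite commgg; exact: sgrp1.
have K0t : K0 t by split=> // _ ->; case: ct => _; apply.
have xyE : x ^ y = x * t^-1 by rewrite /t /commg /conjg !gnorm.
have tE : t = (x ^ y)^-1 * x by rewrite /t /commg /conjg !gnorm.
have s0 : abelian_section K0 A B' by exact: sub_section sK0 sAB'.
set C0 := action_kernel K0 A B'.
have sgC0 : is_subgroup C0 by exact: action_kernel_subgroup.
have nC0 : normalises K0 C0 by exact: action_kernel_norm.
have CC0 k : K0 k -> C k -> C0 k.
  by move=> K0k [_ fk]; split=> // a Aa; apply/sBB'/fk.
have sgZ : is_subgroup (fixed_mod K0 K0 C0) by exact: fixed_mod_subgroup.
have Zx : fixed_mod K0 K0 C0 x.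
  split=> // k K0k; apply: CC0; first exact: sgrpR.
  by apply: sgrpRC => //; case: K0k => _; apply.
have Zt : fixed_mod K0 K0 C0 t.
  split=> // k K0k; apply: CC0; first exact: sgrpR.
  by case: ct => _; apply; exact: sK0.
have Zxy : fixed_mod K0 K0 C0 (x ^ y).
  by rewrite xyE; apply: (sgrpM sgZ) => //; exact: (sgrpV sgZ).
apply: (@commuting_unipotent_closed K0 _ _ [:: x; x ^ y]) => //.
- by move=> z; rewrite /= !inE => /orP[]/eqP->.
- move=> z zX a Aa; suff [n Bn] : exists n, B (lncomm a (nseq n z)).
    by exists n; exact: sBB'.
  move: zX a Aa; rewrite !inE => /orP[]/eqP->; first exact: ux.
  exact: (unipotentJ sgK sAB Ky ux).
have tE1 : [set` [:: t]] = [set t].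
  by apply/seteqP; split=> z /=; rewrite inE => /eqP.
move=> a Aa aX; have := @hyperfixed_union_closed _ K A B [:: t] a sgK sAB.
rewrite tE1; apply=> // z; rewrite inE => /eqP->.
have sgX : gen [set` [:: x; x ^ y]] `<=` K0.
  by apply: gen_sub => // w; rewrite /= !inE => /orP[]/eqP->; [|case: Zxy].
apply: (@fixed_mod_gen _ [set` [:: x; x ^ y]] A); first exact: (sec_bot s0).
- by move=> b k /sgX; exact: (sec_normbot s0).
- by split=> // w /=; exact: aX.
- rewrite tE; have sgX' := gen_subgroup [set` [:: x; x ^ y]].
  apply: (sgrpM sgX').
    by apply: (sgrpV sgX'); apply: sub_gen; rewrite /= !inE eqxx orbT.
  by apply: sub_gen; rewrite /= !inE eqxx.
Qed.

(** The left-normed commutators of length [n.+1] with entries in [X]. *)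
Definition comms X n : seq G := iter n (fun s => [seq [~ t, x] | t <- s, x <- X]) X.

Lemma comms_gen X n t : t \in comms X n -> gen [set` X] t.
Proof.
have sgX := gen_subgroup [set` X].
elim: n t => [|n IHn] t; first by move=> tX; exact: (sub_gen tX).
case/allpairsP => -[y x] /= [/IHn gy Xx ->]; apply: (sgrpR sgX) => //.
exact: sub_gen.
Qed.

(** Induction on the class of the acting group.  The commutators of the largest
    length that may act nontrivially are central and unipotent, so they have a
    nonzero submodule of common fixed points, on which the class has dropped. *)
Lemma nilpotent_unipotent_closed X A B c :
  abelian_section (gen [set` X]) A B ->
  (forall x, x \in X -> unipotent x A B) ->
  [set` comms X c] `<=` action_kernel (gen [set` X]) A B ->
  fixed_closed X A B -> A `<=` B.
Proof.
set K := gen _; have sgK : is_subgroup K by exact: gen_subgroup.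
elim: c A => [|c IHc] A s uX cX closed a Aa.
  by apply: closed => // x /cX /action_kernelP; apply=> //; exact: (sec_bot s).
set C := action_kernel K A B in cX.
have sgC : is_subgroup C by exact: action_kernel_subgroup.
have nC : normalises K C by exact: action_kernel_norm.
have central : [set` comms X c] `<=` fixed_mod K K C.
  move=> t /= tc; have Kt := comms_gen tc; split=> // k Kk.
  apply: (@fixed_mod_gen _ [set` X] K) => //; split=> // x /= xX.
  by apply: cX; apply/allpairsP; exists (t, x).
apply: (commuting_unipotent_closed sgK s central) => //.
  case: {IHc cX} c central => // c central t tc.
  case/allpairsP: (tc) (central t tc) => -[y x] /= [yc xX ->] ct.
  apply: (unipotent_commg sgK s) => //; last exact: uX.
    exact: sub_gen.
  exact: comms_gen yc.
have sT : abelian_section K (fixed_mod [set` comms X c] A B) B.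
  by apply: (section_fixed_bot sgK s); apply: normal_mod_central => // k [].
move=> b Ab fb; apply: (IHc _ sT) => //.
- by move=> x xX d [Ad _]; exact: uX.
- move=> t tc; split; first exact: comms_gen tc.
  by move=> d [_ fd]; apply: sgrpRC; [exact: (sec_bot s)|exact: fd].
- by move=> d [Ad _]; exact: closed.
Qed.

Lemma comms_shift X c n A B : [set` comms X c] `<=` hyperfixed [set` X] A B n ->
  [set` comms X (c + n)] `<=` B.
Proof.
elim: n c => [|n IHn] c cn; first by rewrite addn0.
rewrite addnS -addSn; apply: IHn => _ /= /allpairsP[[t x] /= [tc xX ->]].
by case: (cn t tc) => _; apply.
Qed.

(** The union of the submodules [hyperfixed] is the largest one annihilated by
    long commutators; the quotient by it has no fixed points, so it vanishes.
    As [comms X c] is a finite list, one exponent then serves all its elements. *)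
Lemma comms_descent X A B c : abelian_section (gen [set` X]) A B ->
  (forall x, x \in X -> unipotent x A B) ->
  [set` comms X c] `<=` A -> exists n, [set` comms X n] `<=` B.
Proof.
set K := gen _ => s uX cA; have sgK : is_subgroup K by exact: gen_subgroup.
have nX : normal_mod K (action_kernel K A B) [set` X].
  by apply: normal_mod_gen => k [].
have sAU : A `<=` hyperfixed_union A B [set` X].
  apply: (@nilpotent_unipotent_closed X _ _ c).
  - exact: hyperfixed_union_section.
  - by move=> x xX a /(uX x xX)[n Bn]; exists n; exists 0%N.
  - move=> t tc; split; first exact: comms_gen tc.
    move=> a Aa; exists 0%N; apply: (sec_abelian s) => //; exact: cA.
  - by move=> a Aa; exact: (hyperfixed_union_closed sgK s nX).
have [|n cn] := uniform_stage (hyperfixed_mono sgK s nX) (X := comms X c).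
  by move=> t /cA/sAU.
by exists (c + n)%N; exact: comms_shift cn.
Qed.

(** The commutators in the generators climb the upper central series of the
    group, whose terms see arbitrary elements and not only generators. *)
Lemma nilpotent_comms X m : [set` comms X m] `<=` [set 1] ->
  nilpotent (gen [set` X]).
Proof.
set K := gen _ => cX; have sgK : is_subgroup K by exact: gen_subgroup.
pose Z := hyperfixed [set` X] K [set 1].
have Zn n : is_subgroup (Z n) /\ normalises K (Z n).
  elim: n => [|n [sgZ nZ]].
    split; last by move=> _ k _ ->; rewrite /Z /= conj1g.
    split=> [|x y -> ->|x ->]; rewrite /Z /= ?mulg1 ?invg1 //.
  split; first exact: fixed_mod_subgroup.
  apply: fixed_mod_normalised => //; first by move=> a k Kk Ka; exact: (sgrpJ sgK).
  move=> a k t fa Kk Xt; apply: (fixed_mod_gen _ _ fa) => //.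
  by apply: (sgrpJ sgK) => //; exact: (sub_gen Xt).
have cZ n : n <= m -> [set` comms X (m - n)] `<=` Z n.
  elim: n => [|n IHn] nm t /= tc; first by rewrite subn0 in tc; exact: cX tc.
  split=> [|x xX]; first exact: comms_gen tc.
  apply: (IHn (ltnW nm)); rewrite /= -subnSK //.
  by apply/allpairsP; exists (t, x).
have KZ : K `<=` Z m.
  apply: gen_sub; first by have [] := Zn m.
  by move: (cZ m (leqnn m)); rewrite subnn.
have lcZ n : n <= m -> lower_central K n `<=` Z (m - n).
  elim: n => [|n IHn] nm; first by rewrite subn0.
  apply: gen_sub; first by have [] := Zn (m - n.+1).
  move=> _ [a [k [/(IHn (ltnW nm)) + Kk ->]]].
  rewrite -subnSK // => fa; have [sgZ nZ] := Zn (m - n.+1).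
  exact: (fixed_mod_gen _ _ fa).
exists m; apply/seteqP; split; first by move: (lcZ m (leqnn m)); rewrite subnn.
by case: m {cX cZ KZ lcZ} => [|m] _ ->; [exact: (sgrp1 sgK)|exact: (sgrp1 (gen_subgroup _))].
Qed.

End Unipotent.

(** * The action of randomly power Engel elements on abelian sections *)

Section PowerEngel.
Context {G : groupType}.
Implicit Types (H K A B C T : set G) (x y z a b k t : G) (X s : seq G).

Lemma cyc_commute a x y : cyc a x -> cyc a y -> [~ x, y] = 1.
Proof.
have sg1 : is_subgroup [set (1 : G)].
  by split=> [|? ? -> ->|? ->] //=; rewrite ?mulg1 ?invg1.
have n1 H : normalises H [set (1 : G)] by move=> _ k _ ->; rewrite /= conj1g.
have fg z w : [~ z, a] = 1 -> cyc a w -> [~ z, w] = 1.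
  move=> za; apply: (@fixed_mod_gen _ [set a] [set: G] [set 1]) => //.
  by split=> // _ ->.
move=> ax; apply: (fg x); apply/eqP; rewrite commg1_sym; apply/eqP.
by apply: (fg a) ax; exact: commgg.
Qed.

(** Modulo [B], taking commutators with a fixed sequence is additive on [A]. *)
Lemma lncomm_fixed_subgroup A B s : abelian_section [set: G] A B ->
  is_subgroup [set b | A b /\ B (lncomm b s)] /\
  B `<=` [set b | A b /\ B (lncomm b s)].
Proof.
move=> sAB; elim: s => [|y s [sgE BE]].
  suff -> : [set b | A b /\ B (lncomm b [::])] = B by split=> //; exact: (sec_bot sAB).
  by apply/seteqP; split=> [b []//|b Bb]; split=> //; exact: (sec_sub sAB).
set E := [set b | _] in sgE BE.
have -> : [set b | A b /\ B (lncomm b (y :: s))] = fixed_mod [set y] A E.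
  apply/seteqP; split=> b.
    move=> [Ab Bb]; split=> // _ ->; split=> //.
    exact: (normalisesR (sec_top sAB) (sec_normtop sAB)).
  by move=> [Ab] /(_ y erefl)[].
split.
  apply: fixed_mod_subgroup => //; first exact: (sec_top sAB).
  move=> e b Ab Ee; rewrite conjg_mulR; apply: (sgrpM sgE) => //; apply: BE.
  by apply: (sec_abelian sAB) => //; case: Ee.
move=> b Bb; split=> [|_ ->]; first exact: (sec_sub sAB).
by apply: BE; exact: (normalisesR (sec_bot sAB) (sec_normbot sAB)).
Qed.

(** Since [a ^ b = a * [~ a, b]], the factor [a] disappears at the first entry
    of [s]. *)
Lemma lncomm_conj_commuting a b s : (forall y, y \in s -> [~ a, y] = 1) ->
  lncomm (a ^ b) s = 1 -> lncomm [~ a, b] s = 1.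
Proof.
case: s => [_ /eqP|y s ay].
  by rewrite /= conjg_eq1 => /eqP->; rewrite comm1g.
by rewrite /= conjg_mulR commMgR ay ?mem_head // conj1g mul1g.
Qed.

(** Each [y] in [s] generates the same cyclic group as [a], so [y] and [a] have
    the same fixed points modulo every subgroup normalised by this group. *)
Lemma lncomm_generators_hyperfixed A B a b s : abelian_section [set: G] A B ->
  (forall y, y \in s -> cyc y = cyc a) -> A b -> B (lncomm b s) ->
  hyperfixed [set a] A B (size s) b.
Proof.
move=> sAB; elim: s b => //= y s IHs b gs Ab Bb.
have sgK := cyc_subgroup a.
have sK : abelian_section (cyc a) A B by exact: sub_section sAB.
have na : normal_mod (cyc a) (action_kernel (cyc a) A B) [set a].
  by apply: normal_mod_gen => k [].
have [sn _] := hyperfixed_section sgK sK na (size s).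
have cy : cyc y = cyc a by apply: gs; exact: mem_head.
split=> // _ ->; apply: (@fixed_mod_gen _ [set y] A); first exact: (sec_bot sn).
- by rewrite -/(cyc y) cy; exact: (sec_normbot sn).
- split=> // _ ->; apply: IHs => // [z zs|].
    by apply: gs; rewrite inE zs orbT.
  exact: (normalisesR (sec_top sAB) (sec_normtop sAB)).
- by rewrite -/(cyc y) cy; exact: cyc_id.
Qed.

Lemma power_Engel_hyperfixed A B a b n : abelian_section [set: G] A B ->
  A b -> power_Engel_at n a b -> hyperfixed [set a] A B n b.
Proof.
move=> sAB Ab [a1 [s [<- gs Eb]]].
apply: lncomm_generators_hyperfixed => // [y /gs[]//|].
have [sgE _] := lncomm_fixed_subgroup (a1 :: s) sAB.
have [sgEs _] := lncomm_fixed_subgroup s sAB.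
suff main c : A c -> lncomm (a1 ^ c) s = 1 -> B (lncomm c (a1 :: s)).
  case: Eb => [|Eb]; first exact: main.
  (* Conjugating by [b^-1] turns the second form into the first for [b^-1]. *)
  have AVb := sgrpV (sec_top sAB) Ab.
  suff /(sgrpV sgE) : [set d | A d /\ B (lncomm d (a1 :: s))] b^-1.
    by rewrite invgK => -[].
  split=> //; apply: main => //.
  move: (congr1 (conjg^~ b^-1) Eb); rewrite /= lncommJ conj1g -map_comp => <-.
  by congr lncomm; rewrite -[LHS]map_id; apply: eq_map => y /=; rewrite conjgK.
move=> Ac /lncomm_conj_commuting Es.
have {}Es : lncomm [~ a1, c] s = 1.
  apply: Es => y ys; apply: (@cyc_commute a).
    by case: (gs a1); rewrite ?mem_head.
  by case: (gs y); rewrite // inE ys orbT.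
have AR : A [~ c, a1] by exact: (normalisesR (sec_top sAB) (sec_normtop sAB)).
suff /(sgrpV sgEs) : [set d | A d /\ B (lncomm d s)] [~ a1, c].
  by rewrite invgR => -[].
split; first exact: (sgrpRC (sec_top sAB)).
by rewrite Es; exact: sgrp1 (sec_bot sAB).
Qed.

(** In the sequence [x, x, ..., x] the first entry is conjugated by [g], so the
    Engel condition is used at [x ^ g], and one more entry is needed. *)
Lemma left_Engel_sub : left_Engel G `<=` randomly_power_Engel G.
Proof.
move=> x Ex g; have [n n0 xn] := Ex (x ^ g); exists n.+1 => //.
exists x, (nseq n x); split; [by rewrite /= size_nseq| |by left].
by move=> b; rewrite inE mem_nseq => /orP[/eqP->|/andP[_ /eqP->]]; split=> //; exact: cyc_id.
Qed.

Lemma bounded_left_Engel_sub :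
  bounded_left_Engel G `<=` bounded_randomly_power_Engel G.
Proof.
move=> x [n n0 xn]; exists n.+1 => // g.
exists x, (nseq n x); split; [by rewrite /= size_nseq| |by left].
by move=> b; rewrite inE mem_nseq => /orP[/eqP->|/andP[_ /eqP->]]; split=> //; exact: cyc_id.
Qed.

End PowerEngel.

(** * The derived series *)

Section Derived.
Context {G : groupType}.
Implicit Types (H K A B C T M N : set G) (x y z a b k t : G) (X s : seq G).

Lemma gen_norm K A : normalises K A -> normalises K (gen A).
Proof.
move=> nA x k Kk; have [g1 gM gV] := gen_subgroup A.
apply: (gen_sub (H := [set x | gen A (x ^ k)])) => [|a Aa]; last by apply: sub_gen; exact: nA.
split=> [|y z gy gz|y gy] /=; first by rewrite conj1g.
  by rewrite conjMg; exact: gM.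
by rewrite conjVg; exact: gV.
Qed.

Lemma derived_subgroup_norm n :
  is_subgroup (derived [set: G] n) /\ normalises [set: G] (derived [set: G] n).
Proof.
elim: n => [|n [sgD nD]]; first by split=> //; exact: setT_subgroup.
split; first exact: gen_subgroup.
apply: gen_norm => _ k _ [x [y [Dx Dy ->]]].
by exists (x ^ k), (y ^ k); split; [exact: nD|exact: nD|by rewrite conjRg].
Qed.

Lemma derived_section n :
  abelian_section [set: G] (derived [set: G] n) (derived [set: G] n.+1).
Proof.
have [sgD nD] := derived_subgroup_norm n.
have [sgD' nD'] := derived_subgroup_norm n.+1.
split=> //.
  by apply: gen_sub => // _ [x [y [Dx Dy ->]]]; exact: sgrpR.
by move=> a b Da Db; apply: sub_gen; exists a, b.
Qed.

Definition derived_unipotent : set G :=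
  [set x | forall n, unipotent x (derived [set: G] n) (derived [set: G] n.+1)].

(** Conjugacy invariance makes the subgroup generated by these elements normal. *)
Lemma derived_unipotentJ x k : derived_unipotent x -> derived_unipotent (x ^ k).
Proof.
move=> ux n; exact: (unipotentJ setT_subgroup (derived_section n)).
Qed.

Lemma randomly_power_Engel_unipotent : randomly_power_Engel G `<=` derived_unipotent.
Proof.
move=> a Ea n b Db; have [m _ Em] := Ea b; exists m.
by apply: hyperfixed1P; exact: power_Engel_hyperfixed (derived_section n) Db Em.
Qed.

(** Commutators in [X] sink along the derived series, reaching [1]. *)
Lemma derived_unipotent_nilpotent X : soluble [set: G] ->
  [set` X] `<=` derived_unipotent -> nilpotent (gen [set` X]).
Proof.
move=> [d Gd] uX.
suff [m cX] : exists m, [set` comms X m] `<=` derived [set: G] d.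
  by apply: (@nilpotent_comms _ _ m); rewrite -Gd.
elim: d {Gd} => [|d [m cX]]; first by exists 0%N.
apply: comms_descent cX; first exact: sub_section (derived_section d).
by move=> x /uX; apply.
Qed.

Lemma lower_central_mono H K n : H `<=` K ->
  lower_central H n `<=` lower_central K n.
Proof.
move=> sHK; elim: n => //= n IHn; apply: gen_mono => _ [x [y [Hx Hy ->]]].
by exists x, y; split; [exact: IHn|exact: sHK|].
Qed.

Lemma lower_central1 H n : is_subgroup H -> lower_central H n 1.
Proof. by case: n => [|n] sgH; [exact: sgrp1|exact: sgrp1 (gen_subgroup _)]. Qed.

Lemma nilpotentS H K : is_subgroup H -> H `<=` K -> nilpotent K -> nilpotent H.
Proof.
move=> sgH sHK [n Kn]; exists n; apply/seteqP; split.
  by rewrite -Kn; exact: lower_central_mono.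
by move=> _ ->; exact: lower_central1.
Qed.

Lemma gen_finite A x : gen A x -> exists X, [set` X] `<=` A /\ gen [set` X] x.
Proof.
apply: (gen_sub (H := [set x | exists X, [set` X] `<=` A /\ gen [set` X] x])).
  split=> [|y z [X [sX gy]] [Y [sY gz]]|y [X [sX gy]]].
  - by exists [::]; split=> [y|]; rewrite /= ?in_nil //; exact: sgrp1 (gen_subgroup _).
  - exists (X ++ Y); split.
      by move=> t /=; rewrite mem_cat => /orP[]; [exact: sX|exact: sY].
    apply: (sgrpM (gen_subgroup _)).
      by apply: gen_mono gy => t /= tX; rewrite mem_cat tX.
    by apply: gen_mono gz => t /= tX; rewrite mem_cat tX orbT.
  - by exists X; split=> //; exact: (sgrpV (gen_subgroup _)).
move=> a Aa; exists [:: a]; split=> [t|]; first by rewrite /= inE => /eqP->.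
by apply: sub_gen; rewrite /= inE.
Qed.

(** Local nilpotency of [gen A] reduces to finite subsets of [A], because
    finitely many elements of it involve finitely many elements of [A]. *)
Lemma gen_finite_seq A s : [set` s] `<=` gen A ->
  exists X, [set` X] `<=` A /\ [set` s] `<=` gen [set` X].
Proof.
elim: s => [|x s IHs] sA; first by exists [::]; split=> t; rewrite /= in_nil.
have [X [sX gx]] := gen_finite (sA x (mem_head _ _)).
have [|Y [sY gs]] := IHs.
  by move=> t /= ts; apply: sA; rewrite /= inE ts orbT.
exists (X ++ Y); split=> t /=.
  by rewrite mem_cat => /orP[]; [exact: sX|exact: sY].
rewrite inE => /orP[/eqP->|/gs].
  by apply: gen_mono gx => z /= zX; rewrite mem_cat zX.
by apply: gen_mono => z /= zX; rewrite mem_cat zX orbT.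
Qed.

Lemma gen_locally_nilpotent A :
  (forall X, [set` X] `<=` A -> nilpotent (gen [set` X])) ->
  locally_nilpotent (gen A).
Proof.
move=> nA s /gen_finite_seq[X [/nA nX sX]].
by apply: nilpotentS nX; [exact: gen_subgroup|apply: gen_sub => //; exact: gen_subgroup].
Qed.

(** The commutator [[~ a, x]] and [x] lie in [M], hence generate a nilpotent
    group, whose class bounds the number of further commutators with [x]. *)
Lemma locally_nilpotent_left_Engel M : normal_in M [set: G] ->
  locally_nilpotent M -> M `<=` left_Engel G.
Proof.
move=> [sgM _ _ nM] lM x Mx a.
have Mc : M [~ a, x] by rewrite commgEr; apply: (sgrpM sgM) => //; apply: nM => //; exact: sgrpV.
have [|n Hn] := lM [:: [~ a, x]; x].
  by move=> t; rewrite /= !inE => /orP[]/eqP->.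
exists n.+1 => //; set H := gen _ in Hn.
have Hgen t : t \in [:: [~ a, x]; x] -> H t by move=> ?; exact: sub_gen.
suff : lower_central H n (lncomm a (nseq n.+1 x)) by rewrite Hn.
elim: n {Hn} => [|n IHn]; first by apply: Hgen; rewrite mem_head.
rewrite lncomm_nseqS; apply: sub_gen; exists (lncomm a (nseq n.+1 x)), x.
by split=> //; apply: Hgen; rewrite !inE eqxx orbT.
Qed.

Lemma gen_derived_unipotent : soluble [set: G] ->
  normal_in (gen derived_unipotent) [set: G] /\
  locally_nilpotent (gen derived_unipotent).
Proof.
move=> sG; split.
  split=> //; first exact: gen_subgroup.
  move=> x k + _; apply: gen_norm => // y h _; exact: derived_unipotentJ.
by apply: gen_locally_nilpotent => X; exact: derived_unipotent_nilpotent.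
Qed.

Lemma unipotent_left_Engel : soluble [set: G] ->
  gen derived_unipotent `<=` left_Engel G.
Proof. by case/gen_derived_unipotent; exact: locally_nilpotent_left_Engel. Qed.

(** Closing the cycle of inclusions through the left Engel elements. *)
Lemma randomly_power_Engel_gen : soluble [set: G] ->
  randomly_power_Engel G = gen derived_unipotent.
Proof.
move=> sG; apply/seteqP; split.
  by move=> x /randomly_power_Engel_unipotent; exact: sub_gen.
by move=> x /(unipotent_left_Engel sG); exact: left_Engel_sub.
Qed.

Lemma randomly_power_Engel_left_Engel : soluble [set: G] ->
  randomly_power_Engel G = left_Engel G.
Proof.
move=> sG; apply/seteqP; split; last exact: left_Engel_sub.
by rewrite randomly_power_Engel_gen //; exact: unipotent_left_Engel.
Qed.

Lemma randomly_power_Engel_radical : soluble [set: G] ->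
  is_Hirsch_Plotkin_radical (randomly_power_Engel G).
Proof.
move=> sG; have [nN lN] := gen_derived_unipotent sG.
rewrite randomly_power_Engel_gen //; split=> // M nM lM.
rewrite -randomly_power_Engel_gen // => x /(locally_nilpotent_left_Engel nM lM).
exact: left_Engel_sub.
Qed.

End Derived.

(** * Series indexed by pairs of naturals in lexicographic order *)

Section LexSeries.

Definition lexle (u v : option (nat * nat)) : bool :=
  match u, v with
  | _, None => true
  | None, Some _ => false
  | Some (p, j), Some (q, k) => (p < q) || (p == q) && (j <= k)
  end.

Lemma lexle_well_order : wochoice.well_order lexle.
Proof.
apply: wochoice.antisymmetric_well_order => [[[p j]|] [[q k]|] //=|A].
  by move=> pq; congr (Some (_, _)); lia.
have [[p0 [j0 Apj0]]|nA] := pselect (exists p j, Some (p, j) \in A); last first.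
  case=> -[[p j] Apj|AN]; first by case: nA; exists p, j.
  exists None; split=> // -[[p j] Apj|//]; by case: nA; exists p, j.
move=> _; have exp : exists p, `[< exists j, Some (p, j) \in A >].
  by exists p0; apply/asboolP; exists j0.
case: (ex_minnP exp) => p /asboolP exj pmin.
case: (ex_minnP exj) => j Apj jmin; exists (Some (p, j)); split=> // -[[q k] Aqk|//] /=.
have pq : p <= q by apply: pmin; apply/asboolP; exists k.
case: (eqVneq p q) Aqk => [<- /jmin|] /=; lia.
Qed.

Lemma lex_before p j q k : before lexle (Some (p, j)) (Some (q, k)) <->
  p < q \/ p = q /\ j < k.
Proof.
split=> [[/= le_pq ne]|lt_pq].
  case: (ltngtP p q) le_pq ne => //= [_ _ _|<- jk ne]; first by left.
  right; split=> //; rewrite ltn_neqAle jk andbT; apply/eqP => jk'.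
  by apply: ne; rewrite jk'.
by split=> /= [|[]]; lia.
Qed.

Lemma lex_succ p j : succ_of lexle (Some (p, j)) (Some (p, j.+1)).
Proof.
split; first by apply/lex_before; right.
move=> [[q k] [/lex_before + /lex_before]|[_ []]//]; lia.
Qed.

Lemma lex_succE p j v : succ_of lexle (Some (p, j)) v -> v = Some (p, j.+1).
Proof.
move=> [pjv nv]; apply: contrapT => ne; apply: (nv (Some (p, j.+1))).
split; first by apply/lex_before; right.
case: v {nv} pjv ne => [[q k] /lex_before pq ne|_ _]; last by split.
apply/lex_before; case: pq => [|[pq jk]]; first by left.
right; split=> //; rewrite ltn_neqAle jk andbT; apply/eqP => jk'.
by apply: ne; rewrite pq jk'.
Qed.

(** The order type is that of countably many copies of the naturals with a
    greatest index [None].  Successors have the form [(p, j.+1)], so the only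
    limits are the indices [(p.+1, 0)] and [None]. *)
Lemma ascendant_lex (G : groupType) (S : nat -> nat -> set G) K d :
  (forall p j, normal_in (S p j) (S p j.+1)) ->
  (forall p, S p.+1 0%N = \bigcup_j S p j) ->
  S d 0%N = K -> is_subgroup K -> (forall p j, S p j `<=` K) ->
  ascendant (S 0%N 0%N) K.
Proof.
move=> nS limS Sd sgK SK.
have mono p q j : p < q -> S p j `<=` S q 0%N.
  elim: q => // q IHq; rewrite ltnS leq_eqVlt limS => /orP[/eqP<-|/IHq sq] x Sx.
    by exists j.
  by exists 0%N => //; exact: sq.
exists (option (nat * nat)), lexle, (Some (0, 0)%N), None.
exists (fun u => if u is Some (p, j) then S p j else K).
split; split=> //.
- exact: lexle_well_order.
- by case=> [[[|p] j]|].
- by case=> [[]|].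
- by case=> [[p j]|] //; case: (nS p j).
- move=> [[p j]|] v; first by move/lex_succE => ->.
  by case: v => [[q k]|] [[]].
move=> [[[|p] [|j]]|] [].
- by move=> [[[q k]/lex_before|[]//]]; lia.
- by move=> _ /(_ (Some (0, j)%N)); case; exact: lex_succ.
- move=> _ _; rewrite limS; apply/seteqP; split=> x.
    by move=> [k _ Sx]; exists (Some (p, k)) => //; apply/lex_before; left.
  move=> [[[q k]|] /=]; last by case.
  move=> /lex_before qp Sx.
  rewrite -limS; apply: mono Sx; lia.
- by move=> _ /(_ (Some (p.+1, j)%N)); case; exact: lex_succ.
- move=> _ _; apply/seteqP; split=> x.
    by move=> Kx; exists (Some (d, 0%N)); [split|rewrite Sd].
  by move=> [[[q k]|] _] //; exact: SK.
Qed.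

Lemma subnormal_prepend (G : groupType) (H K L : set G) :
  normal_in H K -> subnormal K L -> subnormal H L.
Proof.
move=> nHK [n [S [S0 Sn nS]]].
exists n.+1, (fun i => if i is i'.+1 then S i' else H); split=> //.
by case=> [_|i]; [rewrite S0|exact: nS].
Qed.

End LexSeries.

(** * Ascendance of the cyclic subgroups generated by unipotent elements *)

Section Ascent.
Context {G : groupType}.
Implicit Types (H K A B C E N : set G) (x y z a b g h : G).

(** The part in [N] of the product [H E]. *)
Definition product_in N H E : set G :=
  [set g | N g /\ exists h, H h /\ E (h^-1 * g)].

Lemma product_in_subgroup N H E : is_subgroup N -> is_subgroup H ->
  is_subgroup E -> normalises H E -> is_subgroup (product_in N H E).
Proof.
move=> sgN sgH sgE nE; split.
- split; first exact: sgrp1.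
  by exists 1; rewrite invg1 mulg1; split; exact: sgrp1.
- move=> g g' [Ng [h [Hh Eh]]] [Ng' [h' [Hh' Eh']]].
  split; first exact: sgrpM.
  exists (h * h'); split; first exact: sgrpM.
  have -> : (h * h')^-1 * (g * g') = (h^-1 * g) ^ h' * (h'^-1 * g').
    by rewrite /conjg !gnorm.
  by apply: (sgrpM sgE) => //; exact: nE.
- move=> g [Ng [h [Hh Eh]]]; split; first exact: sgrpV.
  exists h^-1; split; first exact: sgrpV.
  have -> : h^-1^-1 * g^-1 = (h^-1 * g)^-1 ^ h^-1 by rewrite /conjg !gnorm.
  by apply: nE; exact: sgrpV.
Qed.

(** With [E_n] for the [n]-th term, conjugation by [E_(n+1)] moves elements of
    [<x>] only by factors in [E_n]; it preserves [E_n], which contains [E] and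
    with it all commutators of elements of [A]. *)
Lemma product_in_normal N A E x n : is_subgroup N ->
  abelian_section (cyc x) A E ->
  normal_in (product_in N (cyc x) (hyperfixed [set x] A E n))
            (product_in N (cyc x) (hyperfixed [set x] A E n.+1)).
Proof.
move=> sgN s; have sgx := cyc_subgroup x.
have nx : normal_mod (cyc x) (action_kernel (cyc x) A E) [set x].
  by apply: normal_mod_gen => k [].
have [sn _] := hyperfixed_section sgx s nx n.
have [sn' _] := hyperfixed_section sgx s nx n.+1.
split.
- by apply: product_in_subgroup => //; [exact: (sec_bot sn)|exact: (sec_normbot sn)].
- by apply: product_in_subgroup => //; [exact: (sec_bot sn')|exact: (sec_normbot sn')].
- move=> g [Ng [h [Hh Eh]]]; split=> //; exists h; split=> //.
  by move: Eh; exact: (hyperfixed_mono sgx s nx).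
move=> g g' [Ng [h [Hh Eh]]] [Ng' [h' [Hh' Eh']]].
split; first exact: sgrpJ.
exists (h ^ h'); split; first exact: (sgrpJ sgx).
set e := h^-1 * g in Eh; set e' := h'^-1 * g' in Eh'.
have -> : (h ^ h')^-1 * g ^ g' = [~ h ^ h', e'] * (e ^ h') ^ e'.
  by rewrite /e /e' /commg /conjg !gnorm.
apply: (sgrpM (sec_bot sn)).
  apply: (sgrpRC (sec_bot sn)).
  by apply: (fixed_mod_gen (sec_bot sn) (sec_normbot sn) Eh'); exact: (sgrpJ sgx).
have Ae' : A e' by case: Eh'.
by apply: (section_norm sn) => //; exact: (sec_normbot sn).
Qed.

Lemma unipotent_hyperfixed A B x a n : abelian_section [set: G] A B -> A a ->
  B (lncomm a (nseq n x)) -> hyperfixed [set x] A B n a.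
Proof.
move=> s Aa Ba; rewrite -[n in hyperfixed _ _ _ n](size_nseq n x).
by apply: lncomm_generators_hyperfixed => // y; rewrite mem_nseq => /andP[_ /eqP->].
Qed.

Section Series.
Variables (x : G) (N : set G) (d : nat).
Hypotheses (Gd : derived [set: G] d = [set 1]) (sgN : is_subgroup N) (Nx : N x).

Let D := derived [set: G].

(** The block [p] of the series climbs the derived factor [D (d - p.+1) / D (d - p)].
    For [p >= d] both of its terms are [D 0], the whole group, so that the series
    stays at [N]. *)
Definition engel_stage p j : set G :=
  product_in N (cyc x) (hyperfixed [set x] (D (d - p.+1)) (D (d - p)) j).

Let level_section p : abelian_section [set: G] (D (d - p.+1)) (D (d - p)).
Proof.
case: (ltnP p d) => [pd|dp].
  by rewrite -[in D (d - p)]subnSK //; exact: derived_section.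
have -> : (d - p.+1 = 0)%N by lia.
by have -> : (d - p = 0)%N by lia.
Qed.

Let level_xsection p : abelian_section (cyc x) (D (d - p.+1)) (D (d - p)).
Proof. exact: sub_section (level_section p). Qed.

Lemma engel_stage_normal p j : normal_in (engel_stage p j) (engel_stage p j.+1).
Proof. exact: product_in_normal. Qed.

Lemma engel_stage_bottom : engel_stage 0 0 = cyc x.
Proof.
apply/seteqP; split=> [g [Ng [h [Hh]]]|g xg].
  rewrite /= subn0 /D Gd => /mulg1_eq; rewrite invgK => <-; exact: Hh.
split; first exact: cyc_sub Nx _ xg.
by exists g; split=> //; rewrite /= subn0 /D Gd mulVg.
Qed.

Lemma engel_stage_top : engel_stage d 0 = N.
Proof.
apply/seteqP; split=> [g []//|g Ng]; split=> //; exists 1.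
by split; [exact: sgrp1 (cyc_subgroup x)|rewrite /= subnn].
Qed.

Lemma engel_stage_sub p j : engel_stage p j `<=` N.
Proof. by move=> g []. Qed.

Lemma engel_stage_subS p j : engel_stage p j `<=` engel_stage p.+1 0.
Proof.
move=> g [Ng [h [Hh Eh]]]; split=> //; exists h; split=> //=.
have nx : normal_mod (cyc x) (action_kernel (cyc x) (D (d - p.+1)) (D (d - p))) [set x].
  by apply: normal_mod_gen => k [].
have [sj _] := hyperfixed_section (cyc_subgroup x) (level_xsection p) nx j.
exact: (sec_sub sj).
Qed.

Lemma engel_stage_limit p : derived_unipotent x ->
  engel_stage p.+1 0 = \bigcup_j engel_stage p j.
Proof.
move=> ux; apply/seteqP; split=> [g [Ng [h [Hh /= Ah]]]|g [j _]]; last exact: engel_stage_subS.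
suff [j Ej] : exists j, hyperfixed [set x] (D (d - p.+1)) (D (d - p)) j (h^-1 * g).
  by exists j => //; split=> //; exists h.
case: (ltnP p d) => [pd|dp].
  have [n Bn] := ux _ _ Ah; exists n; apply: unipotent_hyperfixed => //.
  by rewrite -subnSK.
by exists 0%N; have -> : (d - p = 0)%N by lia.
Qed.

(** A uniform exponent [k] ends each block after [k] steps. *)
Lemma engel_stage_stationary p k :
  (forall n a, D n a -> hyperfixed [set x] (D n) (D n.+1) k a) ->
  engel_stage p k = engel_stage p.+1 0.
Proof.
move=> ux; apply/seteqP; split=> [g|g [Ng [h [Hh /= Ah]]]]; first exact: engel_stage_subS.
split=> //; exists h; split=> //.
case: (ltnP p d) => [pd|dp].
  by rewrite -[in D (d - p)]subnSK //; exact: ux.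
have nx : normal_mod (cyc x) (action_kernel (cyc x) (D (d - p.+1)) (D (d - p))) [set x].
  by apply: normal_mod_gen => h' [].
have [_ Bk] := hyperfixed_section (cyc_subgroup x) (level_xsection p) nx k.
by apply: Bk; have -> : (d - p = 0)%N by lia.
Qed.

End Series.

Lemma derived_unipotent_ascendant x N : soluble [set: G] -> is_subgroup N ->
  N x -> derived_unipotent x -> ascendant (cyc x) N.
Proof.
move=> [d Gd] sgN Nx ux; rewrite -(engel_stage_bottom Gd sgN Nx).
apply: (ascendant_lex (d := d)) => //.
- by move=> p j; exact: engel_stage_normal.
- by move=> p; exact: engel_stage_limit.
- exact: engel_stage_top.
- by move=> p j; exact: engel_stage_sub.
Qed.

Lemma randomly_power_Engel_Gruenberg : soluble [set: G] ->
  Gruenberg (randomly_power_Engel G).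
Proof.
move=> sG; have [[sgN _ _ _] _ _] := randomly_power_Engel_radical sG.
split=> // x Ex; apply: derived_unipotent_ascendant => //.
exact: randomly_power_Engel_unipotent.
Qed.

Lemma bounded_randomly_power_Engel_subnormal x : soluble [set: G] ->
  bounded_randomly_power_Engel G x -> subnormal (cyc x) [set: G].
Proof.
move=> [d Gd] [k _ Ek].
have sgT := @setT_subgroup G.
have ux n a : derived [set: G] n a ->
    hyperfixed [set x] (derived [set: G] n) (derived [set: G] n.+1) k a.
  by move=> Da; apply: power_Engel_hyperfixed (Ek a) => //; exact: derived_section.
rewrite -(engel_stage_bottom Gd sgT I).
suff step q : q <= d -> subnormal (engel_stage x [set: G] d (d - q) 0) [set: G].
  by have := step d (leqnn d); rewrite subnn.
elim: q => [_|q IHq qd].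
  by rewrite subn0 engel_stage_top; exists 0%N, (fun=> [set: G]).
suff layer j : j <= k -> subnormal (engel_stage x [set: G] d (d - q.+1) (k - j)) [set: G].
  by have := layer k (leqnn k); rewrite subnn.
elim: j => [_|j IHj jk].
  by rewrite subn0 engel_stage_stationary // subnSK //; exact: IHq (ltnW qd).
have kj : (k - j = (k - j.+1).+1)%N by lia.
move: (IHj (ltnW jk)); rewrite kj; apply: subnormal_prepend.
exact: engel_stage_normal.
Qed.

End Ascent.

(** * Bounded Engel elements and the Baer radical *)

Section Power.
Variable G : groupType.

(** In this power of [G], an equation satisfied by the identity function is
    satisfied by all elements of [G] simultaneously. *)
Definition self_power : Type := G -> G.

HB.instance Definition _ := Choice.copy self_power (G -> G).

Let pmul (f g : self_power) : self_power := fun t => f t * g t.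
Let pone : self_power := fun=> 1.
Let pinv (f : self_power) : self_power := fun t => (f t)^-1.

Let pmulA : associative pmul.
Proof. by move=> f g h; apply/funext => t; exact: mulgA. Qed.

Let pmul1 : left_id pone pmul.
Proof. by move=> f; apply/funext => t; exact: mul1g. Qed.

Let pmulr1 : right_id pone pmul.
Proof. by move=> f; apply/funext => t; exact: mulg1. Qed.

Let pmulV : left_inverse pone pinv pmul.
Proof. by move=> f; apply/funext => t; exact: mulVg. Qed.

Let pmulrV : right_inverse pone pinv pmul.
Proof. by move=> f; apply/funext => t; exact: mulgV. Qed.

HB.instance Definition _ :=
  isGroup.Build self_power pmulA pmul1 pmulr1 pmulV pmulrV.

Definition diag (x : G) : self_power := fun=> x.

Lemma lncomm_diag (f : self_power) x n t :
  lncomm f (nseq n (diag x)) t = lncomm (f t) (nseq n x).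
Proof. by elim: n f => // n IHn f; rewrite /= IHn. Qed.

Lemma self_power_soluble : soluble [set: G] -> soluble [set: self_power].
Proof.
move=> [d Gd]; exists d.
have sub n (f : self_power) t : derived [set: self_power] n f -> derived [set: G] n (f t).
  elim: n f => // n IHn f.
  apply: (gen_sub (H := [set f : self_power | derived [set: G] n.+1 (f t)])).
    have sgD : is_subgroup (derived [set: G] n.+1) by exact: gen_subgroup.
    split=> [|g h|g]; [exact: (sgrp1 sgD)|exact: (sgrpM sgD)|exact: (sgrpV sgD)].
  move=> _ [g [h [/IHn Dg /IHn Dh ->]]]; apply: sub_gen.
  by exists (g t), (h t).
apply/seteqP; split=> [f Df|_ ->].
  by apply/funext => t; have := sub _ _ t Df; rewrite Gd.
by case: d {Gd sub} => [|d] //; exact: sgrp1 (gen_subgroup _).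
Qed.

(** The exponent for the identity function is uniform on [G]. *)
Lemma bounded_left_Engel_diag x :
  bounded_left_Engel G x <-> left_Engel self_power (diag x).
Proof.
split=> [[n n0 xn] f|Ex]; first by exists n => //; apply/funext => t; rewrite lncomm_diag xn.
have [n n0 xn] := Ex (fun t => t); exists n => // a.
by rewrite -(lncomm_diag (fun t => t) x n a) xn.
Qed.

(** The left Engel elements of the power form a subgroup, of which the bounded
    ones of [G] are the trace on the diagonal. *)
Lemma bounded_left_Engel_subgroup : soluble [set: G] ->
  is_subgroup (bounded_left_Engel G).
Proof.
move=> /self_power_soluble sP.
have [[sgN _ _ _] _ _] := randomly_power_Engel_radical sP.
rewrite randomly_power_Engel_left_Engel // in sgN.
split=> [|x y|x]; rewrite !bounded_left_Engel_diag.
- exact: (sgrp1 sgN).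
- exact: (sgrpM sgN).
- exact: (sgrpV sgN).
Qed.

(** Each commutator with [x] descends one term of the series, from [[set: G]] to
    the abelian group [cyc x] in [n] steps. *)
Lemma subnormal_bounded_left_Engel x :
  subnormal (cyc x) [set: G] -> bounded_left_Engel G x.
Proof.
move=> [n [S [S0 Sn nS]]]; exists n.+1 => // a.
have Sx i : i <= n -> S i x.
  elim: i => [_|i IHi lt_in]; first by rewrite S0; exact: cyc_id.
  by have [_ _ sub _] := nS i lt_in; apply: sub; exact: IHi (ltnW lt_in).
have Sa i : i <= n -> S (n - i)%N (lncomm a (nseq i x)).
  elim: i => [_|i IHi lt_in]; first by rewrite subn0 Sn.
  have lt' : n - i.+1 < n by lia.
  have [sgS _ _ norm] := nS _ lt'; have := IHi (ltnW lt_in).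
  rewrite -subnSK // lncomm_nseqS commgEr => Sa; apply: (sgrpM sgS).
    by apply: norm => //; apply: (sgrpV sgS); apply: Sx; exact: leq_subr.
  by apply: Sx; exact: leq_subr.
rewrite lncomm_nseqS; apply: (@cyc_commute _ x); last exact: cyc_id.
by have := Sa n (leqnn n); rewrite subnn S0.
Qed.

Lemma Baer_radical_sub : soluble [set: G] -> Baer_radical G `<=` bounded_left_Engel G.
Proof.
move=> sG; have sgE := bounded_left_Engel_subgroup sG; apply: gen_sub => //.
move=> y [x /= /subnormal_bounded_left_Engel Ex].
exact: cyc_sub.
Qed.

Lemma bounded_randomly_power_Engel_Baer : soluble [set: G] ->
  bounded_randomly_power_Engel G `<=` Baer_radical G.
Proof.
move=> sG x Ex; apply: sub_gen; exists x; last exact: cyc_id.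
exact: bounded_randomly_power_Engel_subnormal.
Qed.

End Power.

Theorem theorem2p5 (G : groupType) (hG : soluble [set: G]) :
  (is_Hirsch_Plotkin_radical (randomly_power_Engel G) /\
   Gruenberg (randomly_power_Engel G) /\
   randomly_power_Engel G = left_Engel G) /\
  (bounded_randomly_power_Engel G = Baer_radical G /\
   bounded_randomly_power_Engel G = bounded_left_Engel G).
Proof.
have BL := Baer_radical_sub hG; have RB := bounded_randomly_power_Engel_Baer hG.
have LR := @bounded_left_Engel_sub G.
split; split; first exact: randomly_power_Engel_radical.
- split; first exact: randomly_power_Engel_Gruenberg.
  exact: randomly_power_Engel_left_Engel.
- by apply/seteqP; split=> // x /BL/LR.
- by apply/seteqP; split=> // x /RB/BL.
Qed.
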